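(* There is an absolute constant $C>0$ such that the following holds. Let $\mathcal{F}$ be any finite subset of $\mathbb{Z}^m$, let $d$ be its diameter in the Euclidean norm, let $P=\mathrm{conv}(\mathcal{F})$ and let $M$ be the unary facet complexity of $P$. Then for every function $p:\mathcal{F}\to\mathbb{R}_{>0}$ and every $\varepsilon>0$, with $R=C\,m^{3/2}M\big(L_p+\log|\mathcal{F}|+\log\frac{dm}{\varepsilon}\big)$, for all $\theta_1,\theta_2\in P$ with $\|\theta_1-\theta_2\|_1\le\varepsilon$ we have $$\|q^{\theta_1}-q^{\theta_2}\|_1\le\sqrt{R}\sqrt{\varepsilon}.$$
   Context: For finite $\mathcal{F}\subseteq\mathbb{Z}^m$, $p:\mathcal{F}\to\mathbb{R}_{>0}$ (write $p_\alpha=p(\alpha)$) and $\theta\in P=\mathrm{conv}(\mathcal{F})$, $q^\theta$ denotes the optimal solution of the generalized max-entropy program: maximize $\sum_{\alpha\in\mathcal{F}}q_\alpha\log\frac{p_\alpha}{q_\alpha}$ subject to $\sum_{\alpha}q_\alpha\alpha=\theta$, $\sum_\alpha q_\alpha=1$, $q\ge0$ (a distribution on $\mathcal{F}$). $L_p=\max_{\alpha\in\mathcal{F}}|\log p_\alpha|$. Unary facet complexity: for a polytope $P$ with integer vertices, the smallest $M\in\mathbb{N}$ such that $P=\{x:\langle a_i,x\rangle\le b_i,\ i\in I\}\cap H$ with $I$ finite, $a_i\in\mathbb{Z}^m$, $\|a_i\|_\infty\le M$, $b_i\in\mathbb{R}$, and $H$ a linear subspace of $\mathbb{R}^m$.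
   Formalization: The formal theorem adds the condition log(dm/ε) ≥ 0 (ε ≤ dm when F has at least two points), since for F={0,1}, p=1, ε=2 one has R=0 while q^0 and q^1 are at distance 2; singletons are covered with log 0 = 0. *)

(* Defs.v *)
From HB Require Import structures.
From mathcomp Require Import all_boot all_order all_algebra finmap.
From mathcomp Require Import boolp classical_sets reals exp.

Set Implicit Arguments.
Unset Strict Implicit.
Unset Printing Implicit Defensive.

Import Order.TTheory GRing.Theory Num.Theory.
Local Open Scope ring_scope.
Local Open Scope classical_set_scope.

Section Defs.
Variables (R : realType) (m : nat).
Implicit Types (F : {fset 'rV[int]_m}) (P : set 'rV[R]_m).

Definition int_vec (a : 'rV[int]_m) : 'rV[R]_m := map_mx intr a.

Definition dotp (u v : 'rV[R]_m) : R := \sum_(i < m) u 0 i * v 0 i.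

(* MathComp-Analysis's norm on matrices is the sup norm, so the l1 and l2
   norms are spelled out. *)
Definition l1norm (u : 'rV[R]_m) : R := \sum_(i < m) `|u 0 i|.

Definition l2norm (u : 'rV[R]_m) : R := Num.sqrt (\sum_(i < m) u 0 i ^+ 2).

Definition diameter F : R :=
  \big[Num.max/0]_(a : F) \big[Num.max/0]_(b : F)
    l2norm (int_vec (val a) - int_vec (val b)).

Definition is_distribution F (q : F -> R) : Prop :=
  (forall a, 0 <= q a) /\ \sum_(a : F) q a = 1.

Definition mean F (q : F -> R) : 'rV[R]_m :=
  \sum_(a : F) q a *: int_vec (val a).

Definition conv_hull F : set 'rV[R]_m :=
  [set x | exists q : F -> R, is_distribution q /\ mean q = x].

(* Terms with q a = 0 contribute 0, the usual convention 0 log (p / 0) = 0. *)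
Definition gen_entropy F (p q : F -> R) : R :=
  \sum_(a : F) q a * ln (p a / q a).

Definition feasible F (theta : 'rV[R]_m) (q : F -> R) : Prop :=
  is_distribution q /\ mean q = theta.

Definition is_max_entropy F (p : F -> R) (theta : 'rV[R]_m) (q : F -> R) :
    Prop :=
  feasible theta q /\
  forall q', feasible theta q' -> gen_entropy p q' <= gen_entropy p q.

Definition log_bound F (p : F -> R) : R := \big[Num.max/0]_(a : F) `|ln (p a)|.

Definition has_facet_description P (M : nat) : Prop :=
  exists (k : nat) (a : 'I_k -> 'rV[int]_m) (b : 'I_k -> R)
         (H : {vspace 'rV[R]_m}),
    (forall i j, `|a i 0 j| <= M%:Z) /\
    P = [set x | (forall i, dotp (int_vec (a i)) x <= b i) /\ x \in H].

Definition is_unary_facet_complexity P (M : nat) : Prop :=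
  has_facet_description P M /\
  forall M' : nat, has_facet_description P M' -> (M <= M')%N.

End Defs.

Arguments int_vec R {m} a.
Arguments diameter R {m} F.
Arguments conv_hull R {m} F.

(* ln x = 0 for x <= 0, so the last term vanishes when F is a singleton. *)
Definition stability_factor (R : realType) (C : R) (m : nat)
    (F : {fset 'rV[int]_m}) (M : nat) (p : F -> R) (eps : R) : R :=
  C * m%:R `^ (3 / 2) * M%:R *
  (log_bound p + ln (#|` F|%fset)%:R + ln (diameter R F * m%:R / eps)).

(* Main.v *)
Require Import Defs.
From HB Require Import structures.
From mathcomp Require Import all_boot all_order all_algebra finmap.
From mathcomp Require Import boolp classical_sets reals sequences exp.
From mathcomp Require Import ring lra.

(* Let q2 be optimal at theta2, and assume by symmetry that its entropy is at
   most that of q1, the optimum at theta1.  First-order optimality of q2, via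
   Farkas' lemma, gives an affine function L with p exp(- L) = q2 on the support
   of q2 and p exp(- L) negligible elsewhere; by duality L(theta2) is the
   entropy of q2.  If v minimises L over F, then L - L(v) is on P a nonnegative
   combination of at most m slacks b_i - <a_i, .> of facets through v.  These
   slacks are integers on F, so truncating the coefficients at a level
   D ~ L_p + log |F| + log (d m / eps) makes p exp(- L) larger only where it
   stays negligible.  The truncated L is m M D-Lipschitz for the l1-norm and, up
   to a small additive constant, Q = p exp(- L) is still a subprobability with
   L(theta2) the entropy of q2.  Hence the relative entropies of q1 and of q2
   with respect to Q are O(m M D eps), and comparison with the Hellinger
   distance bounds the l1-distance between q1 and q2. *)

Set Implicit Arguments.
Unset Strict Implicit.

Import Order.TTheory GRing.Theory Num.Theory.
Local Open Scope ring_scope.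
Local Open Scope classical_set_scope.

(** * Cones *)

(* Bartl's induction: if the last functional cannot be dropped, some x1 violates
   the conclusion without it; projecting along x1 onto the kernel of that
   functional eliminates it. *)
Lemma farkas (R : realFieldType) (V : lmodType R) (I : eqType) (s : seq I)
    (a : I -> V -> R) (c : V -> R) :
  uniq s -> (forall i, scalar (a i)) -> scalar c ->
  (forall x, (forall i, i \in s -> a i x <= 0) -> c x <= 0) ->
  exists b : I -> R, (forall i, 0 <= b i) /\
    forall x, c x = \sum_(i <- s) b i * a i x.
Proof.
elim: s a c => [|j s IH] a c /=.
  move=> _ _ sc H; exists (fun=> 0); split=> // x; rewrite big_nil.
  have c0 : c 0 = 0.
    by have := sc 1 0 0; rewrite scaler0 mul1r addr0 => /esym/eqP; rewrite -subr_eq0 addrK => /eqP.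
  have := sc (-1) x 0; rewrite addr0 c0 addr0 mulN1r => cN.
  apply/eqP; rewrite eq_le H //= -oppr_le0 -cN.
  by apply: H.
move=> /andP[js us] sa sc H.
have [H'|] := pselect (forall x, (forall i, i \in s -> a i x <= 0) -> c x <= 0).
  have [b [b0 bE]] := IH a c us sa sc H'.
  exists (fun i => if i == j then 0 else b i); split=> [i|x]; first by case: eqP.
  rewrite big_cons eqxx mul0r add0r bE; apply: eq_big_seq => i ins.
  by case: eqP => // ij; rewrite -ij ins in js.
move=> /existsNP[x1 /not_implyP[ax1 /negP]]; rewrite -ltNge => cx1.
have ajx1 : 0 < a j x1.
  rewrite ltNge; apply/negP => ajx1; move: cx1; apply/negP; rewrite -leNgt.
  by apply: H => i; rewrite inE => /orP[/eqP->|/ax1].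
pose t i := a i x1 / a j x1; pose tc := c x1 / a j x1.
pose x0 x := (- (a j x / a j x1)) *: x1 + x.
have aE i x : a i (x0 x) = a i x - t i * a j x by rewrite sa /t; field; lra.
have cE x : c (x0 x) = c x - tc * a j x by rewrite sc /tc; field; lra.
have [//||||b [b0 bE]] := IH (fun i x => a i x - t i * a j x)
   (fun x => c x - tc * a j x).
- by move=> i k u v /=; rewrite !sa; ring.
- by move=> k u v /=; rewrite sc sa; ring.
- move=> x ax; rewrite -cE; apply: H => i; rewrite aE inE => /orP[/eqP->|/ax//].
  by rewrite /t divff ?gt_eqF// mul1r subrr.
(* [x1] meets the constraints of [s] and makes [c] and [a j] positive, so [t i <= 0] on [s] and
   [tc > 0]; hence [bj >= 0]. *)
pose bj := tc - \sum_(i <- s) b i * t i.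
exists (fun i => if i == j then bj else b i); split=> [i|x].
  case: eqP => // _; rewrite subr_ge0; apply: (@le_trans _ _ 0).
    rewrite big_seq; apply: sumr_le0 => k ks; rewrite mulr_ge0_le0//.
    by rewrite /t pmulr_lle0 ?invr_gt0 // ax1.
  by rewrite /tc divr_ge0 // ltW.
rewrite big_cons eqxx.
have -> : \sum_(i <- s) (if i == j then bj else b i) * a i x =
          \sum_(i <- s) b i * a i x.
  apply: eq_big_seq => i ins; case: eqP => // ij; by rewrite -ij ins in js.
have := bE x; under eq_bigr do rewrite mulrBr mulrA.
rewrite sumrB -mulr_suml /bj => E.
by rewrite mulrBl -(subrK (tc * a j x) (c x)) E; ring.
Qed.

(** More than [m] active vectors are linearly dependent. Subtracting from [b] the largest multiple
    of a dependency [d] that keeps all coefficients nonnegative (a minimal ratio [b i / d i]) kills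
    one of them without enlarging the support; induct on the support size. *)
Lemma caratheodory_cone (R : realFieldType) (m : nat) (I : finType)
    (a : I -> 'rV[R]_m) (b : I -> R) :
  (forall i, 0 <= b i) ->
  exists b' : I -> R,
    [/\ forall i, 0 <= b' i, forall i, b i = 0 -> b' i = 0,
        \sum_i b' i *: a i = \sum_i b i *: a i &
        (#|[set i | b' i != 0%R]%SET| <= m)%N].
Proof.
have [n] := ubnP #|[set i | b i != 0%R]%SET|.
elim: n b => // n IH b; rewrite ltnS => bn b0.
have [bm|bm] := leqP #|[set i | b i != 0%R]%SET| m; first by exists b.
set S := [set i | b i != 0%R]%SET in bn bm.
pose A : 'M[R]_(#|S|, m) := \matrix_(r < #|S|) a (enum_val r).
have : kermx A != 0.
  by rewrite -mxrank_eq0 mxrank_ker -lt0n subn_gt0 (leq_ltn_trans (rank_leq_col _)).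
move=> /rowV0Pn[w /sub_kermxP wA w0].
have [d [dS ds [i0 di0]]] : exists d : I -> R,
    [/\ forall i, b i = 0 -> d i = 0, \sum_i d i *: a i = 0 & exists i, 0 < d i].
  pose d i := \sum_(r < #|S| | enum_val r == i) w 0 r.
  have dE r : d (enum_val r) = w 0 r.
    rewrite /d (big_pred1 r) // => r' /=; by rewrite (inj_eq enum_val_inj).
  have d1 i : b i = 0 -> d i = 0.
    move=> bi; rewrite /d big1 // => r /eqP ri.
    by have := enum_valP r; rewrite ri inE bi eqxx.
  have d2 : \sum_i d i *: a i = 0.
    have {2}<- : w *m A = 0 by [].
    under eq_bigr do rewrite scaler_suml.
    rewrite (exchange_big_dep xpredT) //= mulmx_sum_row; apply: eq_bigr => r _.
    by rewrite (big_pred1 (enum_val r)) /= ?rowK // => i; rewrite eq_sym.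
  have [r wr] : exists r, w 0 r != 0.
    apply/existsP; rewrite -negb_forall; apply: contra w0 => /forallP w0.
    by apply/eqP/rowP => r; rewrite mxE; apply/eqP.
  have [wp|wn] : 0 < w 0 r \/ w 0 r < 0 by move: wr; case: ltgtP; auto.
    by exists d; split=> //; exists (enum_val r); rewrite dE.
  exists (fun i => - d i); split.
  - by move=> i /d1->; rewrite oppr0.
  - by under eq_bigr do rewrite scaleNr; rewrite sumrN d2 oppr0.
  - by exists (enum_val r); rewrite dE oppr_gt0.
pose j := [arg min_(i < i0 | 0 < d i) (b i / d i)]%O.
have [dj jmin] : 0 < d j /\ forall i, 0 < d i -> b j / d j <= b i / d i.
  by rewrite /j; case: arg_minP.
pose t := b j / d j.
have t0 : 0 <= t by rewrite divr_ge0 // ltW.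
pose b1 i := b i - t * d i.
have [||b' [b'0 b'b b's b'm]] := IH b1.
- apply: leq_trans bn; apply: proper_card; apply/fintype.properP; split.
    apply/fintype.subsetP => i; rewrite !inE; apply: contra => /eqP bi.
    by rewrite /b1 bi dS // mulr0 subr0.
  exists j; rewrite !inE.
    by apply/eqP => /dS dj0; rewrite dj0 ltxx in dj.
  by rewrite negbK /b1 /t divfK ?subrr // gt_eqF.
- move=> i; rewrite subr_ge0; have [di|di] := ltP 0 (d i).
    by rewrite -ler_pdivlMr // jmin.
  by rewrite (@le_trans _ _ 0) // mulr_ge0_le0.
exists b'; split=> //.
- by move=> i bi; apply: b'b; rewrite /b1 bi dS // mulr0 subr0.
- rewrite b's; under eq_bigr do rewrite scalerBl -scalerA.
  by rewrite sumrB -scaler_sumr ds scaler0 subr0.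
Qed.

(** * Normal cones of the polytope and optimality conditions *)

Lemma uniformly_small (R : realFieldType) (I : finType) (P : I -> R -> Prop) :
  (forall i, exists e, 0 < e /\ forall t, 0 < t <= e -> P i t) ->
  exists2 t, 0 < t & forall i, P i t.
Proof.
move=> /choice[e eP]; exists (\big[Num.min/1]_i e i).
  by apply/bigmin_gtP; split=> [//|i _]; have [] := eP i.
move=> i; have [_] := eP i; apply; rewrite bigmin_le // andbT.
by apply/bigmin_gtP; split=> [//|j _]; have [] := eP j.
Qed.

Section Dotp.
Variables (R : realType) (m : nat).
Implicit Types u v w : 'rV[R]_m.

Lemma dotp_is_scalar u : scalar (dotp u).
Proof.
move=> k v w; rewrite /dotp mulr_sumr -big_split /=; apply: eq_bigr => i _.
by rewrite !mxE; ring.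
Qed.

HB.instance Definition _ u :=
  GRing.isLinear.Build R 'rV[R]_m R *%R (dotp u) (dotp_is_scalar u).

Lemma dotpC u v : dotp u v = dotp v u.
Proof. by apply: eq_bigr => i _; rewrite mulrC. Qed.

Lemma dotp_suml (I : finType) (b : I -> R) (a : I -> 'rV[R]_m) v :
  dotp (\sum_i b i *: a i) v = \sum_i b i * dotp (a i) v.
Proof.
by rewrite dotpC linear_sum; apply: eq_bigr => i _; rewrite linearZ /= dotpC.
Qed.

Lemma dotp_mean (F : {fset 'rV[int]_m}) (q : F -> R) u :
  dotp u (mean q) = \sum_a q a * dotp u (int_vec R (val a)).
Proof. by rewrite /mean linear_sum; apply: eq_bigr => a _; rewrite linearZ. Qed.

Lemma dotp_le_l1norm (a : 'rV[int]_m) (M : nat) u :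
  (forall j, `|a 0 j| <= M%:Z) -> `|dotp (int_vec R a) u| <= M%:R * l1norm u.
Proof.
move=> aM; apply: le_trans (ler_norm_sum _ _ _) _.
rewrite mulr_sumr; apply: ler_sum => i _; rewrite normrM ler_wpM2r // mxE.
by rewrite -intr_norm -[M%:R]/(M%:Z%:~R) ler_int.
Qed.

(** Integrality of slacks: a facet whose coefficient is cut to [D] still contributes at least [D]
    wherever its slack is nonzero. *)
Lemma dotp_int_ge1 (a u v : 'rV[int]_m) :
  0 < dotp (int_vec R a) (int_vec R u - int_vec R v) ->
  1 <= dotp (int_vec R a) (int_vec R u - int_vec R v).
Proof.
have -> : dotp (int_vec R a) (int_vec R u - int_vec R v) =
          (\sum_j a 0 j * (u 0 j - v 0 j))%:~R.
  rewrite rmorph_sum; apply: eq_bigr => j _.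
  by rewrite !mxE rmorphM rmorphB.
by rewrite ltr0z -[1]/(1%:~R) ler_int -gtz0_ge1.
Qed.

Lemma conv_hull_vertex (F : {fset 'rV[int]_m}) (v : F) :
  conv_hull R F (int_vec R (val v)).
Proof.
exists (fun a => (a == v)%:R); split; first split=> [a|].
- exact: ler0n.
- by rewrite (bigD1 v) //= eqxx big1 ?addr0 // => a /negbTE->.
- rewrite /mean (bigD1 v) //= eqxx scale1r big1 ?addr0 // => a /negbTE->.
  by rewrite scale0r.
Qed.

(** A direction of [H] obeying the constraints tight at [v] stays in the polytope for a short step,
    so [lam] cannot decrease along it. Farkas inside [H] then expresses [- lam] by tight normals,
    and Caratheodory leaves at most [m] of them. Differences of points of the polytope lie in [H],
    so the identity holds there. *)
Lemma normal_cone (F : {fset 'rV[int]_m}) (k : nat) (a : 'I_k -> 'rV[int]_m)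
    (b : 'I_k -> R) (H : {vspace 'rV[R]_m}) (lam : 'rV[R]_m) (v : F) :
  conv_hull R F = [set x | (forall i, dotp (int_vec R (a i)) x <= b i) /\
                           x \in H] ->
  (forall w : F, dotp lam (int_vec R (val v)) <= dotp lam (int_vec R (val w))) ->
  exists be : 'I_k -> R,
    [/\ forall i, 0 <= be i,
        forall i, be i != 0 -> b i = dotp (int_vec R (a i)) (int_vec R (val v)),
        (#|[set i | be i != 0%R]%SET| <= m)%N &
        forall x, conv_hull R F x ->
          dotp lam (x - int_vec R (val v)) =
          \sum_i be i * dotp (int_vec R (a i)) (int_vec R (val v) - x)].
Proof.
set v' := int_vec R (val v) => PE vmin.
have vP : conv_hull R F v' by exact: conv_hull_vertex.
have lamP x : conv_hull R F x -> dotp lam v' <= dotp lam x.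
  move=> [q [[q0 q1] <-]]; rewrite dotp_mean -[leLHS]mul1r -q1 mulr_suml.
  by apply: ler_sum => w _; rewrite ler_wpM2l.
have [vb vH] : (forall i, dotp (int_vec R (a i)) v' <= b i) /\ v' \in H.
  by move: vP; rewrite PE.
pose s := [seq i <- enum 'I_k | b i == dotp (int_vec R (a i)) v'].
have [|||x sx|be0 [be0_ge0 be0E]] := @farkas R (subvs_of H) _ s
    (fun i x => dotp (int_vec R (a i)) (vsval x)) (fun x => - dotp lam (vsval x)).
- by rewrite filter_uniq ?enum_uniq.
- by move=> i t x y; rewrite !linearP.
- by move=> t x y; rewrite !linearP /=; ring.
(* Tight constraints allow any step; a constraint with positive slack allows slack over [|g| + 1],
   with [g] its growth rate along [x]. *)
- have [t t0 tP] : exists2 t : R, 0 < t &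
      forall i, t * dotp (int_vec R (a i)) (vsval x) <=
                b i - dotp (int_vec R (a i)) v'.
    apply: uniformly_small => i.
    have [ai|ai] := eqVneq (b i) (dotp (int_vec R (a i)) v').
      exists 1; split=> // t /andP[t0 _]; rewrite ai subrr pmulr_rle0 //.
      by apply: sx; rewrite mem_filter ai eqxx mem_enum.
    have si : 0 < b i - dotp (int_vec R (a i)) v'.
      by rewrite subr_gt0 lt_neqAle eq_sym ai vb.
    set g := dotp (int_vec R (a i)) (vsval x); have g0 := normr_ge0 g.
    exists ((b i - dotp (int_vec R (a i)) v') / (`|g| + 1)); split.
      by rewrite divr_gt0 // ltr_wpDl.
    move=> t /andP[t0]; rewrite ler_pdivlMr ?ltr_wpDl //; apply: le_trans.
    by rewrite ler_pM2l // (le_trans (ler_norm g)) // lerDl.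
  have : conv_hull R F (v' + t *: vsval x).
    rewrite PE; split=> [i|]; last by rewrite rpredD // rpredZ // subvsP.
    by rewrite linearD linearZ /= -lerBrDl.
  by move=> /lamP; rewrite linearD linearZ /= lerDl pmulr_rge0 // oppr_le0.
pose be1 i := if i \in s then be0 i else 0.
have be1_ge0 i : 0 <= be1 i by rewrite /be1; case: ifP.
have [be [be_ge0 be_be1 beE be_m]] :=
  caratheodory_cone (fun i => int_vec R (a i)) be1_ge0.
exists be; split=> // [i bei|x].
  have : be1 i != 0 by apply: contraNneq bei => /be_be1->.
  rewrite /be1; case: ifP => [|_]; last by rewrite eqxx.
  by rewrite mem_filter => /andP[/eqP].
rewrite {1}PE => -[_ xH].
have vxH : v' - x \in H by rewrite rpredB.
have := be0E (vsproj H (v' - x)); rewrite vsprojK //.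
rewrite -[in - _]opprB linearN opprK => ->.
rewrite -dotp_suml beE dotp_suml /s big_filter big_enum_cond /= big_mkcond /=.
by apply: eq_bigr => i _; rewrite /be1 mem_filter mem_enum andbT; case: ifP; rewrite ?mul0r.
Qed.
End Dotp.

(** The optimality conditions, with multipliers [lam] and [c]. Off the support the entropy has
    infinite slope, so any finite level [T] can be demanded there; the multipliers depend on [T]. *)
Lemma dual_certificate (R : realType) (m : nat) (F : {fset 'rV[int]_m})
    (p q : F -> R) (theta : 'rV[R]_m) (T : R) :
  (forall a, 0 < p a) -> is_max_entropy p theta q ->
  exists (lam : 'rV[R]_m) (c : R), forall a,
    (q a = 0 -> ln (p a) + T <= c + dotp lam (int_vec R (val a))) /\
    (q a != 0 -> ln (p a / q a) = c + dotp lam (int_vec R (val a))).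
Proof.
move=> p0 [[[q0 q1] qth] qmax].
(* On the support, the gradient of the entropy up to the constant -1, which feasible directions (of
   sum 0) do not see; off it, a finite stand-in for the infinite slope. *)
pose g a := if q a == 0 then ln (p a) + T else ln (p a / q a).
pose phi (o : option 'I_m) (a : F) : R :=
  if o is Some j then (val a 0 j)%:~R else 1.
pose V := {ffun F -> R^o}.
pose f (i : F + option 'I_m * bool) (d : V) : R :=
  match i with
  | inl a => if q a == 0 then - d a else 0
  | inr (o, s) => (-1) ^+ s * \sum_a d a * phi o a
  end.
have sum_scalar (h : F -> R) : scalar (fun d : V => \sum_a d a * h a).
  move=> k u w; rewrite mulr_sumr -big_split; apply: eq_bigr => a _ /=.
  by rewrite !ffunE /= /GRing.scale /=; ring.
(* The cone of directions d along which q + t d stays feasible for small t > 0;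
   [phi] encodes the equality constraints, with both signs. *)
have [|||d dP|b [b0 bE]] := @farkas R V _ (enum {: F + option 'I_m * bool}) f
   (fun d => \sum_a d a * g a).
- exact: enum_uniq.
- move=> [a|[o s]] k u w /=.
    by case: ifP => _; rewrite ?ffunE /= /GRing.scale /=; ring.
  by rewrite sum_scalar; ring.
- exact: sum_scalar.
- have d_off a : q a = 0 -> 0 <= d a.
    by move=> qa; have := dP (inl a) (mem_enum _ _); rewrite /= qa eqxx oppr_le0.
  have d_phi o : \sum_a d a * phi o a = 0.
    apply/eqP; rewrite eq_le -oppr_le0.
    have := dP (inr (o, true)) (mem_enum _ _).
    have := dP (inr (o, false)) (mem_enum _ _).
    by rewrite /= expr0 expr1 mul1r mulN1r => -> ->.
  have d_sum : \sum_a d a = 0.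
    by rewrite -[RHS](d_phi None); apply: eq_bigr => a _; rewrite mulr1.
  rewrite leNgt; apply/negP => dg.
  pose e : R := \sum_a d a * g a; rewrite -/e in dg.
  (* Error allowed per coordinate: the [#|F|] errors together stay below the first-order gain
     [e]. *)
  pose eta : R := e / (#|{: F}|.+1)%:R.
  have eta0 : 0 < eta by rewrite divr_gt0.
  have [t t0 tP] : exists2 t : R, 0 < t & forall a, 0 <= q a + t * d a /\
      q a * ln (p a / q a) + t * (d a * g a - d a - eta) <=
      (q a + t * d a) * ln (p a / (q a + t * d a)).
    apply: uniformly_small => a; rewrite /g; have [qa|qa] := eqVneq (q a) 0.
      have := d_off a qa; rewrite le_eqVlt => /predU1P[<-|da].
        exists 1; split=> // t /andP[t0 _]; rewrite qa mulr0 addr0 !mul0r oppr0 !add0r.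
        by split=> //; rewrite pmulr_rle0 // oppr_le0 ltW.
      (* Up to this step [ln (t * d a) <= - T], so the gain is at least
         [t * d a * (ln (p a) + T)]. *)
      exists (expR (- T) / d a); split; first by rewrite divr_gt0 // expR_gt0.
      move=> t /andP[t0]; rewrite ler_pdivlMr // => tT.
      have td : 0 < t * d a by rewrite mulr_gt0.
      rewrite qa !add0r mul0r add0r ltW //; split=> //.
      rewrite -mulrA ler_pM2l // ln_div ?posrE //.
      have : ln (t * d a) <= - T by rewrite -[leRHS]expRK ler_ln ?posrE ?expR_gt0.
      move=> lnT.
      have : 0 <= d a * (- T - ln (t * d a)) by rewrite mulr_ge0 ?subr_ge0 // ltW.
      by move: (ln (t * d a)) (ln (p a)) => l L; nra.
    have qa0 : 0 < q a by rewrite lt_neqAle eq_sym qa q0.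
    (* The first bound keeps [q a + t * d a] positive, the second keeps the quadratic error
       [t ^+ 2 * d a ^+ 2 / q a] below [t * eta]. *)
    exists (Num.min (q a / (`|d a| + 1)) (eta / (d a ^+ 2 / q a + 1))).
    have da0 := normr_ge0 (d a).
    have dq : 0 <= d a ^+ 2 / q a by rewrite divr_ge0 // ?sqr_ge0 // ltW.
    split.
      by rewrite lt_min !divr_gt0 // ltr_wpDl.
    move=> t /andP[t0]; rewrite le_min ler_pdivlMr ?ltr_wpDl // ler_pdivlMr ?ltr_wpDl //.
    move=> /andP[t1 t2].
    have qtd : 0 < q a + t * d a.
      have := ler_norm (- d a); rewrite normrN; nra.
    split; first exact: ltW.
    have -> : ln (p a / (q a + t * d a)) =
              ln (p a / q a) - ln ((q a + t * d a) / q a).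
      rewrite -ln_div ?posrE ?divr_gt0 //; congr ln.
      by field; rewrite qa gt_eqF.
    have := @le_ln1Dx R (t * d a / q a).
    have -> : 1 + t * d a / q a = (q a + t * d a) / q a by field.
    rewrite ltr_pdivlMr // mulN1r ltrNl -subr_gt0 opprK => /(_ qtd).
    set l := ln (_ / q a); set L := ln (p a / q a) => ll.
    have : 0 <= (q a + t * d a) * (t * d a / q a - l).
      by rewrite mulr_ge0 ?subr_ge0 // ltW.
    have -> : (q a + t * d a) * (t * d a / q a - l) =
      t * d a + t * (t * (d a ^+ 2 / q a)) - (q a + t * d a) * l by field.
    have : t * (t * (d a ^+ 2 / q a)) <= t * eta.
      by rewrite ler_pM2l //; apply: le_trans t2; rewrite mulrDr mulr1 lerDl ltW.
    by lra.
  have := qmax (fun a => q a + t * d a); rewrite /feasible /is_distribution.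
  have -> : \sum_a (q a + t * d a) = 1.
    by rewrite big_split /= -mulr_sumr d_sum mulr0 addr0.
  have -> : mean (fun a => q a + t * d a) = theta.
    rewrite /mean; under eq_bigr do rewrite scalerDl -scalerA.
    rewrite big_split /= -scaler_sumr -[RHS]qth -[RHS]addr0; congr (_ + _).
    rewrite (_ : \sum_a _ = 0) ?scaler0 //; apply/rowP => j.
    rewrite summxE [RHS]mxE -[RHS](d_phi (Some j)); apply: eq_bigr => a _.
    by rewrite !mxE.
  move=> /(_ (conj (conj (fun a => (tP a).1) erefl) erefl)).
  apply/negP; rewrite -ltNge; apply: lt_le_trans (ler_sum _ (fun a _ => (tP a).2)).
  rewrite big_split /= ltrDl -mulr_sumr !sumrB d_sum subr0 sumr_const.
  rewrite mulr_gt0 // subr_gt0 -/e /eta -[ltLHS]mulr_natr.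
  by rewrite -mulrA -[ltRHS]mulr1 ltr_pM2l // mulrC ltr_pdivrMr // mul1r ltr_nat.
pose mu o := b (inr (o, false)) - b (inr (o, true)).
have gE a : g a + (if q a == 0 then b (inl a) else 0) = \sum_o mu o * phi o a.
  have sum_delta (h : F -> R) : \sum_a' [ffun a' => (a' == a)%:R : R^o] a' * h a' = h a.
    rewrite (bigD1 a) //= ffunE eqxx mul1r big1 ?addr0 // => a' /negbTE a'a.
    by rewrite ffunE a'a mul0r.
  (* Evaluating the Farkas identity at the indicator of [a] reads off its coordinate [a]. *)
  have := bE [ffun a' => (a' == a)%:R]; rewrite sum_delta => ->.
  rewrite big_enum /= big_sumType /= (bigD1 a) //= big1 => [|a' /negbTE a'a]; last first.
    by rewrite ffunE a'a oppr0 if_same mulr0.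
  rewrite ffunE eqxx addr0 addrAC [X in X + _](_ : _ = 0) ?add0r; last first.
    by case: ifP; rewrite ?mulr1n ?mulrN1 ?addNr ?mulr0 ?addr0.
  rewrite (eq_bigl xpredT) //.
  rewrite (eq_bigr (fun x => b (inr (x.1, x.2)) * ((-1) ^+ x.2 * phi x.1 a))).
    rewrite -(pair_bigA _ (fun o s => b (inr (o, s)) * ((-1) ^+ s * phi o a))) /=.
    by apply: eq_bigr => o _; rewrite big_bool expr0 expr1 /mu /=; ring.
  by move=> [o s] _; rewrite sum_delta.
exists (\row_j mu (Some j)), (mu None) => a.
have -> : mu None + dotp (\row_j mu (Some j)) (int_vec R (val a)) =
          \sum_o mu o * phi o a.
  rewrite (bigD1 None) //= mulr1; congr (_ + _); rewrite (reindex_omap Some id) /=.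
    by apply: eq_big => j; rewrite ?eqxx // !mxE.
  by case.
rewrite -gE /g; have [qa|qa] := eqVneq (q a) 0; split=> //.
- by rewrite lerDl.
- by move=> qa0; rewrite qa0 eqxx in qa.
- by rewrite addr0.
Qed.

(** * Relative entropy and truncated certificates *)

(** Since [r - q] has sum at most 0, adding it reduces the claim to single terms, where
    [ln x <= x - 1] at the square root of [r i / q i] suffices. *)
Lemma hellinger_le_KL (R : realType) (I : finType) (q r : I -> R) :
  (forall i, 0 <= q i) -> \sum_i q i = 1 ->
  (forall i, 0 < r i) -> \sum_i r i <= 1 ->
  \sum_i (Num.sqrt (q i) - Num.sqrt (r i)) ^+ 2 <= - \sum_i q i * ln (r i / q i).
Proof.
move=> q0 q1 r0 r1.
apply: (@le_trans _ _ (\sum_i (r i - q i - q i * ln (r i / q i)))); last first.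
  by rewrite !sumrB q1 gerDr subr_le0.
apply: ler_sum => i _; set u := Num.sqrt (q i); set w := Num.sqrt (r i).
have w0 : 0 < w by rewrite sqrtr_gt0.
have qE : q i = u ^+ 2 by rewrite sqr_sqrtr.
have rE : r i = w ^+ 2 by rewrite sqr_sqrtr // ltW.
rewrite qE rE; have := sqrtr_ge0 (q i); rewrite -/u le_eqVlt => /predU1P[<-|u0].
  by nra.
have -> : w ^+ 2 / u ^+ 2 = (w / u) ^+ 2 by rewrite expr_div_n.
have wu : 0 < w / u by rewrite divr_gt0.
rewrite lnXn // mulr2n.
have := @le_ln1Dx R (w / u - 1); rewrite addrCA subrr addr0 ltrBrDr addNr => /(_ wu) lnu.
have : 0 <= u ^+ 2 * (w / u - 1 - ln (w / u)) by rewrite mulr_ge0 ?sqr_ge0 ?subr_ge0.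
have -> : u ^+ 2 * (w / u - 1 - ln (w / u)) = u * w - u ^+ 2 - u ^+ 2 * ln (w / u).
  by field; rewrite gt_eqF.
by nra.
Qed.

(** Factor [q1 - q2] as a difference of squares of roots: one factor is controlled through the root
    of [r], the other by the total mass. AM-GM plays the part of Cauchy-Schwarz. *)
Lemma l1_le_hellinger (R : realType) (I : finType) (q1 q2 r : I -> R) (B : R) :
  (forall i, 0 <= q1 i) -> \sum_i q1 i = 1 ->
  (forall i, 0 <= q2 i) -> \sum_i q2 i = 1 -> 0 < B ->
  \sum_i (Num.sqrt (q1 i) - Num.sqrt (r i)) ^+ 2 <= B ->
  \sum_i (Num.sqrt (q2 i) - Num.sqrt (r i)) ^+ 2 <= B ->
  \sum_i `|q1 i - q2 i| <= 4 * Num.sqrt B.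
Proof.
move=> q1_ge0 q1_sum q2_ge0 q2_sum B0 B1 B2.
set k := Num.sqrt B; have k0 : 0 < k by rewrite sqrtr_gt0.
have BE : B = k * k by rewrite -expr2 sqr_sqrtr // ltW.
pose h i := (Num.sqrt (q1 i) - Num.sqrt (r i)) ^+ 2 +
            (Num.sqrt (q2 i) - Num.sqrt (r i)) ^+ 2.
apply: (@le_trans _ _ (\sum_i (k^-1 * h i + k * (q1 i + q2 i)))); last first.
  rewrite big_split -!mulr_sumr !big_split q1_sum q2_sum /=.
  have : k^-1 * (\sum_i (Num.sqrt (q1 i) - Num.sqrt (r i)) ^+ 2 +
          \sum_i (Num.sqrt (q2 i) - Num.sqrt (r i)) ^+ 2) <= k^-1 * (k * k + k * k).
    by rewrite ler_pM2l ?invr_gt0 // -BE lerD.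
  have -> : k^-1 * (k * k + k * k) = 2 * k by field; rewrite gt_eqF.
  by lra.
apply: ler_sum => i _; rewrite /h.
set u1 := Num.sqrt (q1 i); set u2 := Num.sqrt (q2 i); set w := Num.sqrt (r i).
have -> : q1 i = u1 ^+ 2 by rewrite sqr_sqrtr.
have -> : q2 i = u2 ^+ 2 by rewrite sqr_sqrtr.
have u10 : 0 <= u1 := sqrtr_ge0 _.
have u20 : 0 <= u2 := sqrtr_ge0 _.
have -> : `|u1 ^+ 2 - u2 ^+ 2| = `|u1 - u2| * (u1 + u2).
  by rewrite subr_sqr normrM (ger0_norm (addr_ge0 u10 u20)).
(* AM-GM with weight [k] *)
have amgm (x y : R) : x * y <= (k^-1 * x ^+ 2 + k * y ^+ 2) / 2.
  rewrite -subr_ge0.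
  have -> : (k^-1 * x ^+ 2 + k * y ^+ 2) / 2 - x * y = k^-1 * (x - k * y) ^+ 2 / 2.
    by field; rewrite gt_eqF.
  by rewrite divr_ge0 // mulr_ge0 ?sqr_ge0 // invr_ge0 ltW.
apply: le_trans (amgm _ _) _; rewrite real_normK ?num_real //.
have : k^-1 * (u1 - u2) ^+ 2 <= k^-1 * (2 * ((u1 - w) ^+ 2 + (u2 - w) ^+ 2)).
  by rewrite ler_pM2l ?invr_gt0 //; have := sqr_ge0 (u1 + u2 - 2 * w); nra.
have : k * (u1 + u2) ^+ 2 <= k * (2 * (u1 ^+ 2 + u2 ^+ 2)).
  by rewrite ler_pM2l //; have := sqr_ge0 (u1 - u2); nra.
by nra.
Qed.

Section Certificate.
Variables (R : realType) (m : nat) (F : {fset 'rV[int]_m}).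
Implicit Types (p q : F -> R) (theta lam : 'rV[R]_m).

(** The mean of an affine function under [q] depends only on [theta], so this relative entropy is a
    duality gap. *)
Lemma KL_affine p q theta lam (c : R) :
  (forall a, 0 < p a) -> feasible theta q ->
  - \sum_a q a * ln (p a * expR (- (c + dotp lam (int_vec R (val a)))) / q a) =
  c + dotp lam theta - gen_entropy p q.
Proof.
move=> p0 [[q0 q1] <-]; rewrite dotp_mean -[c in RHS]mul1r -q1 mulr_suml.
rewrite -big_split -sumrB -sumrN; apply: eq_bigr => a _ /=.
have := q0 a; rewrite le_eqVlt => /predU1P[<-|qa]; first by rewrite !mul0r; ring.
by rewrite mulrAC [ln (_ * expR _)]lnM ?posrE ?divr_gt0 ?expR_gt0 // expRK; ring.
Qed.

Lemma log_bound_ge p a : `|ln (p a)| <= log_bound p.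
Proof. exact: le_bigmax. Qed.

Lemma truncated_certificate p q theta (M : nat) (e : R) :
  has_facet_description (conv_hull R F) M ->
  (forall a, 0 < p a) -> is_max_entropy p theta q -> 0 < e ->
  let D := 2 * log_bound p + ln #|{: F}|%:R - ln e in
  0 <= D ->
  exists lam c,
    [/\ \sum_a p a * expR (- (c + dotp lam (int_vec R (val a)))) <= 1,
        c + dotp lam theta <= gen_entropy p q + 2 * e &
        forall w, `|dotp lam w| <= m%:R * M%:R * D * l1norm w].
Proof.
move=> [k [a [b [H [aM PE]]]]] p0 qmax e0 D D0.
have [[[q0 q1] qth] _] := qmax.
have thP : conv_hull R F theta by exists q.
pose N : R := #|{: F}|%:R.
have [a0 _|noF] := pickP {: F}; last first.
  by move: q1; rewrite big_pred0 // => /eqP; rewrite eq_sym oner_eq0.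
have N0 : 0 < N by rewrite ltr0n; apply/card_gt0P; exists a0.
(* This level gives each point off the support a mass of at most [e / N], hence at most [e] in
   total. *)
have [lam0 [c1 cert]] := dual_certificate (ln N - ln e) p0 qmax.
pose v : F := [arg min_(i < a0) dotp lam0 (int_vec R (val i))]%O.
have vmin (w : F) : dotp lam0 (int_vec R (val v)) <= dotp lam0 (int_vec R (val w)).
  by rewrite /v; case: arg_minP => // i _ imin; exact: imin w isT.
have [be [be0 betight be_m beE]] := normal_cone PE vmin.
set v' := int_vec R (val v) in vmin betight beE.
pose c0 := c1 + dotp lam0 v'.
pose s i x := dotp (int_vec R (a i)) (v' - x).
have s0 i x : be i != 0 -> conv_hull R F x -> 0 <= s i x.
  move=> /betight bi; rewrite {1}PE /s linearB /= subr_ge0 -bi => -[xb _]; exact: xb.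
pose be' i := Num.min (be i) D.
have be'_ge0 i : 0 <= be' i by rewrite le_min be0.
have LE z : c0 + 2 * e + \sum_i be' i * dotp (int_vec R (a i)) v' +
    dotp (- \sum_i be' i *: int_vec R (a i)) z =
    c0 + 2 * e + \sum_i be' i * s i z.
  rewrite [dotp (- _) _]dotpC linearN /= [dotp z _]dotpC dotp_suml -addrA.
  congr (_ + _); rewrite -sumrB; apply: eq_bigr => i _.
  by rewrite /s linearB /=; ring.
exists (- \sum_i be' i *: int_vec R (a i)),
       (c0 + 2 * e + \sum_i be' i * dotp (int_vec R (a i)) v'); split; last first.
- move=> w; rewrite dotpC linearN normrN /= dotpC dotp_suml.
  apply: le_trans (ler_norm_sum _ _ _) _.
  rewrite (bigID (fun i => be i != 0)) /= [X in _ + X]big1 ?addr0; last first.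
    move=> i; rewrite negbK => /eqP bei.
    by rewrite /be' bei min_l // mul0r normr0.
  apply: (@le_trans _ _ (\sum_(i | be i != 0) D * (M%:R * l1norm w))).
    apply: ler_sum => i _; rewrite normrM ger0_norm // ler_pM //.
      by rewrite ge_min lexx orbT.
    exact: dotp_le_l1norm.
  rewrite sumr_const -[leLHS]mulr_natr.
  have -> : m%:R * M%:R * D * l1norm w = D * (M%:R * l1norm w) * m%:R by ring.
  rewrite ler_wpM2l ?mulr_ge0 ?sumr_ge0 // ler_nat.
  by apply: leq_trans be_m; rewrite cardsE.
- rewrite LE.
  have GE : gen_entropy p q = c1 + dotp lam0 theta.
    rewrite -qth dotp_mean -[c1]mul1r -q1 mulr_suml -big_split.
    apply: eq_bigr => w _ /=; rewrite -mulrDr.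
    have [->|qw] := eqVneq (q w) 0; first by rewrite !mul0r.
    by rewrite (cert w).2.
  have := beE _ thP; rewrite linearB /= => thE.
  have : \sum_i be' i * s i theta <= \sum_i be i * s i theta.
    apply: ler_sum => i _; have [bei|bei] := eqVneq (be i) 0.
      by rewrite /be' bei min_l.
    by rewrite ler_wpM2r ?s0 // ge_min lexx.
  by rewrite GE /c0 -/s; move: thE; rewrite -/v' /s; lra.
pose A := \sum_w p w * expR (- (c1 + dotp lam0 (int_vec R (val w)))).
have A_le : A <= 1 + e.
  have -> : 1 + e = \sum_(w : F) (q w + e / N).
    rewrite big_split /= q1 sumr_const -[RHS]/(1 + (e / N) *+ #|{: F}|).
    by rewrite -mulr_natr divfK // gt_eqF.
  apply: ler_sum => w _; have [qw|qw] := eqVneq (q w) 0.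
    rewrite qw add0r -[p w]lnK ?posrE // -expRD -[leRHS]lnK ?posrE ?divr_gt0 //.
    rewrite ler_expR ln_div ?posrE //.
    by have := (cert w).1 qw; lra.
  have qw0 : 0 < q w by rewrite lt_neqAle eq_sym qw q0.
  rewrite -(cert w).2 // expRN lnK ?posrE ?divr_gt0 // invf_div mulrCA divff.
    by rewrite mulr1 lerDl divr_ge0 // ltW.
  by rewrite gt_eqF.
have sumE : \sum_w p w * expR (- \sum_i be i * s i (int_vec R (val w))) =
            expR c0 * A.
  rewrite mulr_sumr; apply: eq_bigr => w _.
  rewrite mulrCA -expRD -beE; last exact: conv_hull_vertex.
  by rewrite linearB /= /c0; congr (_ * expR _); ring.
(* All slacks vanish at [v]. Thus a truncation error of [e * p v] is at most a fraction [e] of the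
   total mass. *)
have pv_le : p v <= expR c0 * A.
  rewrite -sumE (bigD1 v) //= big1 => [|i _]; last first.
    by rewrite /s subrr linear0 mulr0.
  rewrite oppr0 expR0 mulr1 lerDl sumr_ge0 // => w _.
  by rewrite mulr_ge0 ?expR_ge0 // ltW.
(* Either truncation changes no term at [w], or a truncated facet has slack at least 1 there and the
   exponent is already at most [- D]. *)
have trunc (w : F) : expR (- \sum_i be' i * s i (int_vec R (val w))) <=
    expR (- \sum_i be i * s i (int_vec R (val w))) + expR (- D).
  have wP := conv_hull_vertex R w.
  have sw0 i : 0 <= be' i * s i (int_vec R (val w)).
    have [bei|bei] := eqVneq (be i) 0; first by rewrite /be' bei min_l // mul0r.
    by rewrite mulr_ge0 // s0.
  have [/existsP[i /andP[Di si]]|] :=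
      boolP [exists i, (D < be i) && (s i (int_vec R (val w)) != 0)].
    apply: (@le_trans _ _ (expR (- D))); last by rewrite lerDr expR_ge0.
    rewrite ler_expR lerN2 (bigD1 i) //=.
    rewrite -[leLHS]addr0 lerD ?sumr_ge0 // /be' min_r ?(ltW Di) //.
    rewrite ler_peMr // dotp_int_ge1 // lt_neqAle eq_sym si s0 //.
    by rewrite gt_eqF // (le_lt_trans D0).
  rewrite negb_exists => /forallP H'; apply: ler_wpDr; first exact: expR_ge0.
  rewrite le_eqVlt; apply/orP; left; apply/eqP; congr (expR (- _)).
  apply: eq_bigr => i _; have := H' i; rewrite negb_and negbK -leNgt.
  by case/orP => [Di|/eqP->]; rewrite ?mulr0 // /be' min_l.
(* This fixes the choice of [D]: one factor [expR (- log_bound p)] cancels [p w], the other is at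
   most [p v], and [e / N] is summed over [F]. *)
have eD : expR (- D) = expR (- log_bound p) * expR (- log_bound p) * (e / N).
  rewrite /D -[e in RHS]lnK ?posrE // -[N in RHS]lnK ?posrE // -expRN -!expRD.
  by rewrite -/N; congr expR; ring.
have p_le w : p w <= expR (log_bound p).
  by rewrite -[leLHS]lnK ?posrE // ler_expR (le_trans (ler_norm _)) // log_bound_ge.
have pv_ge : expR (- log_bound p) <= p v.
  rewrite -[leRHS]lnK ?posrE // ler_expR lerNl.
  by rewrite (le_trans (ler_norm _)) // normrN log_bound_ge.
have tail : \sum_w p w * expR (- D) <= e * p v.
  apply: (@le_trans _ _ (\sum_(w : F) e / N * p v)); last first.
    rewrite sumr_const -[leLHS]/((e / N * p v) *+ #|{: F}|) -mulr_natr -/N.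
    by rewrite mulrAC divfK // gt_eqF.
  apply: ler_sum => w _; rewrite eD mulrA [leLHS]mulrC.
  rewrite ler_pM2l ?divr_gt0 // mulrA; apply: le_trans pv_ge.
  by rewrite ler_piMl ?expR_ge0 // expRN ler_pdivrMr ?expR_gt0 // mul1r.
apply: (@le_trans _ _ (expR (- (c0 + 2 * e)) * ((1 + e) * (expR c0 * A)))).
  rewrite (eq_bigr (fun w => expR (- (c0 + 2 * e)) *
      (p w * expR (- \sum_i be' i * s i (int_vec R (val w)))))); last first.
    by move=> w _; rewrite LE mulrCA -expRD -opprD.
  rewrite -mulr_sumr ler_pM2l ?expR_gt0 // mulrDl mul1r.
  apply: (@le_trans _ _ (expR c0 * A + e * p v)); last first.
    by rewrite lerD2l ler_pM2l.
  rewrite -sumE; apply: le_trans (lerD (lexx _) tail); rewrite -big_split /=.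
  by apply: ler_sum => w _; rewrite -mulrDr ler_pM2l // trunc.
have -> : expR (- (c0 + 2 * e)) * ((1 + e) * (expR c0 * A)) =
    expR (- (2 * e)) * ((1 + e) * A).
  rewrite opprD expRD; have := expRxMexpNx_1 c0; move: (expR c0) (expR (- c0)).
  by move=> x y xy; rewrite -[RHS]mul1r -xy; ring.
(* The shift [2 * e] pays for two factors [1 + e], one from the mass off the support and one from
   truncation. *)
rewrite expRN ler_pdivrMl ?expR_gt0 // mulr1.
have -> : 2 * e = e + e by ring.
rewrite expRD; apply: ler_pM; rewrite ?expR_ge1Dx ?addr_ge0 ?(ltW e0) //.
  by apply: sumr_ge0 => w _; rewrite mulr_ge0 ?expR_ge0 // ltW.
by rewrite (le_trans A_le) // expR_ge1Dx.
Qed.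
End Certificate.

(** * Stability *)

Section Nondegenerate.
Variables (R : realType) (m : nat) (F : {fset 'rV[int]_m}).

(** With zero normals, [normal_cone] makes every coordinate functional constant on [F]. This yields
    [1 <= M] once [F] has two points. *)
Lemma facet_description0 (u w : F) :
  has_facet_description (conv_hull R F) 0 -> u = w.
Proof.
move=> [k [a [b [H [a0 PE]]]]].
apply/val_inj/rowP => j; pose lam : 'rV[R]_m := delta_mx 0 j.
have lamE x : dotp lam x = x 0 j.
  rewrite /dotp (bigD1 j) //= mxE !eqxx mul1r big1 ?addr0 // => i ij.
  by rewrite mxE (negbTE ij) andbF mul0r.
pose v : F := [arg min_(i < u) dotp lam (int_vec R (val i))]%O.
have vmin (x : F) : dotp lam (int_vec R (val v)) <= dotp lam (int_vec R (val x)).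
  by rewrite /v; case: arg_minP => // i _ imin; exact: imin x isT.
have [be [_ _ _ beE]] := normal_cone PE vmin.
have const (x : F) : val x 0 j = val v 0 j.
  have := beE _ (conv_hull_vertex R x); rewrite big1 => [|i _].
    by rewrite lamE !mxE => /eqP; rewrite subr_eq0 => /eqP/intr_inj.
  rewrite /dotp big1 ?mulr0 // => l _; have := a0 i l.
  by rewrite normr_le0 mxE => /eqP->; rewrite mul0r.
by rewrite !const.
Qed.

Lemma diameter_ge1 (u w : F) : u != w -> 1 <= diameter R F.
Proof.
move=> uw; apply: (@le_trans _ _ (l2norm (int_vec R (val u) - int_vec R (val w)))).
  rewrite -[leLHS]sqrtr1 ler_sqrt; last exact/sumr_ge0/(fun _ _ => sqr_ge0 _).
  have [j uwj] : exists j, val u 0 j != val w 0 j.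
    apply/existsP; rewrite -negb_forall; apply: contra uw => /forallP uw.
    by apply/eqP/val_inj/rowP => j; apply/eqP.
  rewrite (bigD1 j) //= -[leLHS]addr0 lerD ?sumr_ge0 //; last first.
    by move=> *; rewrite sqr_ge0.
  rewrite !mxE -rmorphB -rmorphXn /= -[1]/(1%:~R) ler_int -gtz0_ge1.
  by rewrite lt_neqAle sqr_ge0 eq_sym expf_neq0 // subr_eq0.
apply: le_trans (le_bigmax _ _ u); exact: le_bigmax.
Qed.

Lemma log_bound_ge0 (p : F -> R) : 0 <= log_bound p.
Proof. exact: bigmax_ge_id. Qed.

Lemma subsingleton_distribution (q1 q2 : F -> R) :
  (forall u w : F, u = w) -> \sum_a q1 a = 1 -> \sum_a q2 a = 1 -> q1 = q2.
Proof.
move=> FF q1E q2E; apply/funext => u.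
have qE (q : F -> R) : \sum_a q a = q u.
  by rewrite (bigD1 u) //= big1 ?addr0 // => w; rewrite (FF w u) eqxx.
by rewrite -(qE q1) -(qE q2) q1E.
Qed.

End Nondegenerate.

(** Keeps the logarithmic factor of [R] away from 0, so that additive errors of order [eps] can be
    absorbed. *)
Lemma ln_nat_ge_half (R : realType) (n : nat) : (1 < n)%N -> 1 / 2 <= ln n%:R :> R.
Proof.
move=> n1; have n0 : 0 < n%:R :> R by rewrite ltr0n ltnW.
have := @le_ln1Dx R (n%:R^-1 - 1); rewrite addrCA subrr addr0 ltrBrDr addNr.
rewrite invr_gt0 => /(_ n0); rewrite lnV ?posrE //.
have : n%:R^-1 <= 2^-1 :> R by rewrite lef_pV2 ?posrE // ler_nat.
by lra.
Qed.

Lemma max_entropy_stability (R : realType) (m : nat) (F : {fset 'rV[int]_m})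
    (M : nat) (p : F -> R) (eps : R) (theta1 theta2 : 'rV[R]_m) (q1 q2 : F -> R) :
  has_facet_description (conv_hull R F) M -> (1 <= M)%N -> (1 <= m)%N ->
  (1 < #|{: F}|)%N -> 1 <= diameter R F ->
  (forall a, 0 < p a) -> 0 < eps -> 0 <= ln (diameter R F * m%:R / eps) ->
  l1norm (theta1 - theta2) <= eps ->
  is_max_entropy p theta1 q1 -> is_max_entropy p theta2 q2 ->
  gen_entropy p q2 <= gen_entropy p q1 ->
  \sum_(a : F) `|q1 a - q2 a|
    <= Num.sqrt (stability_factor 96 M p eps) * Num.sqrt eps.
Proof.
move=> PE M1 m1 F1 d1 p0 eps0 lnd thetas q1max q2max G21.
have [[[q1_ge0 q1_sum] q1_mean] _] := q1max.
have [[[q2_ge0 q2_sum] q2_mean] _] := q2max.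
set Lp := log_bound p; set d := diameter R F in lnd d1 *.
set lF : R := ln #|{: F}|%:R.
have Lp0 : 0 <= Lp := log_bound_ge0 p.
have lF0 : 1 / 2 <= lF := ln_nat_ge_half R F1.
have m1R : 1 <= m%:R :> R by rewrite ler1n.
have M1R : 1 <= M%:R :> R by rewrite ler1n.
have dm : 1 <= d * m%:R by rewrite mulr_ege1.
(* With this tolerance [- ln e] is exactly the last logarithm of the stability factor, and
   [e <= eps]. *)
pose e := eps / (d * m%:R).
have e0 : 0 < e by rewrite divr_gt0 // (lt_le_trans ltr01).
have e_eps : e <= eps by rewrite ler_pdivrMr ?(lt_le_trans ltr01) // ler_peMr // ltW.
have lneE : ln (d * m%:R / eps) = - ln e by rewrite -lnV ?posrE // invf_div.
rewrite lneE in lnd.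
pose Lam := Lp + lF - ln e.
have Lam0 : 1 / 2 <= Lam by rewrite /Lam; lra.
pose D := 2 * Lp + lF - ln e.
have D0 : 0 <= D by rewrite /D; lra.
have D_Lam : D <= 2 * Lam by rewrite /D /Lam; lra.
have [lam [c [Qle1 cert lip]]] := truncated_certificate PE p0 q2max e0 D0.
pose Q a := p a * expR (- (c + dotp lam (int_vec R (val a)))).
have Q0 a : 0 < Q a by rewrite mulr_gt0 // expR_gt0.
pose W := m%:R * M%:R * Lam * eps.
have mM : 1 <= m%:R * M%:R :> R by rewrite mulr_ege1.
(* Hence [2 * e <= 4 * W]; with the Lipschitz term [2 * W] this gives the bound [6 * W] below. *)
have Weps : 1 / 2 * eps <= W.
  rewrite /W ler_pM2r //; apply: (le_trans Lam0); rewrite ler_peMl //.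
  by lra.
have B0 : 0 < 6 * W by lra.
have KL2 : \sum_a (Num.sqrt (q2 a) - Num.sqrt (Q a)) ^+ 2 <= 6 * W.
  apply: le_trans (hellinger_le_KL q2_ge0 q2_sum Q0 Qle1) _.
  by rewrite (KL_affine lam c p0 q2max.1); lra.
have KL1 : \sum_a (Num.sqrt (q1 a) - Num.sqrt (Q a)) ^+ 2 <= 6 * W.
  apply: le_trans (hellinger_le_KL q1_ge0 q1_sum Q0 Qle1) _.
  rewrite (KL_affine lam c p0 q1max.1).
  have : dotp lam (theta1 - theta2) <= 2 * W.
    apply: le_trans (ler_norm _) (le_trans (lip _) _).
    have -> : 2 * W = m%:R * M%:R * (2 * Lam) * eps by rewrite /W; ring.
    apply: ler_pM => //; first by rewrite mulr_ge0 // ?(le_trans ler01).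
      exact: sumr_ge0.
    by rewrite ler_wpM2l // (le_trans ler01).
  by rewrite linearB /=; lra.
apply: le_trans (l1_le_hellinger q1_ge0 q1_sum q2_ge0 q2_sum B0 KL1 KL2) _.
have m32 : m%:R <= m%:R `^ (3 / 2) :> R.
  by rewrite -[leLHS]powRr1 // ler_powR //; lra.
have sfE : stability_factor 96 M p eps = 96 * m%:R `^ (3 / 2) * M%:R * Lam.
  by rewrite /stability_factor -/d lneE -/Lp cardfE -/lF.
have Lam_ge0 : 0 <= Lam by lra.
rewrite -sqrtrM; last by rewrite sfE !mulr_ge0 ?powR_ge0.
(* Source of the constant: 4 times the root of [6 * W] is the root of [96 * W]. *)
have -> : (4 : R) = Num.sqrt 16.
  by rewrite -[RHS]/(Num.sqrt 16) (_ : 16 = 4 ^+ 2) ?sqrtr_sqr ?ger0_norm //; ring.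
rewrite -sqrtrM // ler_sqrt sfE; last by rewrite !mulr_ge0 ?powR_ge0 // ltW.
have -> : 16 * (6 * W) = 96 * m%:R * (M%:R * Lam * eps) by rewrite /W; ring.
have -> : 96 * m%:R `^ (3 / 2) * M%:R * Lam * eps =
    96 * m%:R `^ (3 / 2) * (M%:R * Lam * eps) by ring.
rewrite ler_wpM2r ?mulr_ge0 // ?(ltW eps0) //.
by rewrite ler_pM2l.
Qed.

(* The hypothesis [0 <= ln (d * m / eps)] says eps <= d * m when F has at least
   two points, and always holds when F is a singleton, since then d = 0 and
   [ln 0 = 0].  Without it the bound fails: for F = {0, 1}, p = 1 and eps = 2
   one gets R = 0, while q^0 and q^1 are at l1-distance 2.  No pair of points
   is lost, as the l1-diameter of P is at most d * m. *)
Theorem theorem5p1 (R : realType) :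
  exists C : R, 0 < C /\
    forall (m : nat) (F : {fset 'rV[int]_m}) (M : nat),
    is_unary_facet_complexity (conv_hull R F) M ->
    forall p : F -> R, (forall a, 0 < p a) ->
    forall eps : R, 0 < eps -> 0 <= ln (diameter R F * m%:R / eps) ->
    forall theta1 theta2 : 'rV[R]_m,
    conv_hull R F theta1 -> conv_hull R F theta2 ->
    l1norm (theta1 - theta2) <= eps ->
    forall q1 q2 : F -> R,
    is_max_entropy p theta1 q1 -> is_max_entropy p theta2 q2 ->
    \sum_(a : F) `|q1 a - q2 a|
      <= Num.sqrt (stability_factor C M p eps) * Num.sqrt eps.
Proof.
exists 96; split=> // m F M [PE _] p p0 eps eps0 lnd theta1 theta2 _ _ thetas.
move=> q1 q2 q1max q2max.
have [FF|] := pselect (forall u w : F, u = w).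
  rewrite (subsingleton_distribution FF q1max.1.1.2 q2max.1.1.2) big1.
    by rewrite mulr_ge0 ?sqrtr_ge0.
  by move=> a _; rewrite subrr normr0.
move=> /existsNP[u /existsNP[w /eqP uw]].
have M1 : (1 <= M)%N.
  by case: M PE => // PE; rewrite (facet_description0 u w PE) eqxx in uw.
have m1 : (1 <= m)%N.
  rewrite lt0n; apply: contra_neq uw => m0; apply/val_inj/rowP => -[j jm].
  by have := jm; rewrite {1}m0.
have F1 : (1 < #|{: F}|)%N by apply/card_gt1P; exists u, w.
have d1 := diameter_ge1 R uw.
(* The certificate must come from the optimum of smaller entropy, so the two points are exchanged if
   necessary. *)
have [G21|/ltW G12] := leP (gen_entropy p q2) (gen_entropy p q1).
  exact: (max_entropy_stability PE M1 m1 F1 d1 p0 eps0 lnd thetas q1max q2max).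
under eq_bigr do rewrite distrC.
apply: (max_entropy_stability PE M1 m1 F1 d1 p0 eps0 lnd _ q2max q1max) => //.
by apply: le_trans thetas; apply: ler_sum => i _; rewrite !mxE distrC.
Qed.
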